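(* For every integer $s \geq 2$ there is a positive integer constant $C = C(s)$ such that for every positive integer $n$, setting $N = C n^C$, every function $\chi : \binom{N}{2} \rightarrow [n]$ admits a lexicographic non-increasing set of size $s$.
   Context: $[n]=\{1,\dots,n\}$, and $\chi:\binom{N}{2}\to[n]$ denotes a coloring of the pairs of elements of $\{1,\dots,N\}$; $\chi(x,y)$ is the color of the pair $\{x,y\}$ with $x<y$. A set $x_1 < \dots < x_s$ of elements of $\{1,\dots,N\}$ is lexicographic if there are colors $c_1,\dots,c_{s-1}$ such that one of the following holds: (1) $\chi(x_i,x_j) = c_i$ for all $1 \leq i < j \leq s$; or (2) $\chi(x_i,x_j) = c_{j-1}$ for all $1 \leq i < j \leq s$. A lexicographic set is called non-increasing if moreover $c_1 \geq c_2 \geq \dots \geq c_{s-1}$. *)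

(* Defs.v *)
From mathcomp Require Import all_boot.
Set Implicit Arguments.
Unset Strict Implicit.
Unset Printing Implicit Defensive.

(* The ordered sets {1, ..., N} and [n] = {1, ..., n} are represented by 'I_N
   and 'I_n, and all indices start at 0.  A coloring of the pairs is given by
   chi : 'I_N -> 'I_N -> 'I_n, where chi x y is the color of {x, y} for x < y;
   the values chi x y with y <= x are never used. *)

Definition increasing_enumeration (N s : nat) (S : {set 'I_N})
    (x : 'I_s -> 'I_N) : Prop :=
  (forall i j : 'I_s, i < j -> x i < x j) /\ S = [set x i | i : 'I_s].

(* Cases (1) and (2): the pair (x_i, x_j) with i < j has color c_i, resp.
   c_(j-1).  Both formulas keep their form when all indices are shifted to start
   at 0, the colors being indexed by 'I_s.-1. *)
Definition lexicographic_with (N n s : nat) (chi : 'I_N -> 'I_N -> 'I_n)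
    (S : {set 'I_N}) (c : 'I_s.-1 -> 'I_n) : Prop :=
  exists2 x : 'I_s -> 'I_N, increasing_enumeration S x &
    (forall (i j : 'I_s) (k : 'I_s.-1), i < j -> k = i :> nat ->
       chi (x i) (x j) = c k)
    \/
    (forall (i j : 'I_s) (k : 'I_s.-1), i < j -> k = j.-1 :> nat ->
       chi (x i) (x j) = c k).

Definition nonincreasing_colors (n m : nat) (c : 'I_m -> 'I_n) : Prop :=
  forall k l : 'I_m, k <= l -> c l <= c k.

Definition lexicographic_nonincreasing (N n : nat)
    (chi : 'I_N -> 'I_N -> 'I_n) (s : nat) (S : {set 'I_N}) : Prop :=
  exists2 c : 'I_s.-1 -> 'I_n,
    lexicographic_with chi S c & nonincreasing_colors c.

(* Main.v *)
(** The two kinds of lexicographic sets are exchanged by reversing the order of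
    the vertices and of the colors, so both are treated as "chains" on two
    sides.  Suppose that V has no chain of p + 2 vertices on the first side
    and none of q + 2 vertices on the second.  Keep thresholds A_i (i <= p,
    A_p = n) and B_j (j <= q, B_q = n) such that V has no first-side chain of
    i + 2 vertices with colors below A_i, nor a second-side chain of j + 2
    vertices with reversed colors below B_j.

    If A_i + B_0 >= n for some i < p, then the colors that occur in V are all
    below A_i, and p can be decreased; symmetrically if A_0 + B_j >= n.
    Otherwise every color c, with reversed color c', satisfies c < A_{i+1} and
    c' < B_{j+1} for some pair with A_i + B_j < n.  For a popular pair, cut the
    gap between the thresholds in the middle: some vertex x has a positive
    proportion of V as neighbors with colors between the midpoint m and A_{i+1}
    (or symmetrically).  Each color class c of this neighborhood has no chain of
    i + 2 vertices with colors up to c, since x would extend it; so after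
    passing to the largest of the n classes the threshold at i can be raised
    above m.  This loss of a factor n is not paid at once: the raised threshold
    is only recorded as "avoidable", and each halving of a gap costs a constant
    factor, so closing some gap costs a factor polynomial in n.  Only then are
    the two avoidable thresholds made true ones, at the cost n^2, and this
    happens at most pq times. *)
Require Import Defs.
From mathcomp Require Import all_boot.
From mathcomp Require Import zify.
Set Implicit Arguments.
Unset Strict Implicit.
Unset Printing Implicit Defensive.

(** * Counting by averaging, and weights *)

Lemma pigeonhole (T K : finType) (k0 : K) (U : {set T}) (P : K -> pred T) :
  {in U, forall y, exists k, P k y} ->
  exists k, #|U| <= #|K| * #|[set y in U | P k y]|.
Proof.
move=> cov; pose k := [arg max_(k > k0) #|[set y in U | P k y]|].
exists k; apply: (@leq_trans (\sum_(l : K) #|[set y in U | P l y]|)).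
  have -> : \sum_l #|[set y in U | P l y]| = \sum_(y in U) \sum_l (P l y : nat).
    rewrite exchange_big; apply: eq_bigr => l _.
    rewrite -sum1_card big_mkcond [RHS]big_mkcond; apply: eq_bigr => y _.
    by rewrite inE; case: (y \in U); case: (P l y).
  rewrite -sum1_card; apply: leq_sum => y /cov[l Ply].
  by rewrite (bigD1 l) //= Ply.
rewrite -sum_nat_const; apply: leq_sum => l _.
by rewrite /k; case: arg_maxnP => // i _; apply.
Qed.

(** Twice the sum of the out-degrees is at least [#|V| * (#|V| - 1)], and some vertex reaches the
    average. *)
Lemma large_outdegree (T : finType) (V : {set T}) (out : rel T) :
  {in V &, forall x y, x != y -> out x y || out y x} -> 0 < #|V| ->
  exists2 x, x \in V & #|V| <= (2 * #|[set y in V | out x y]|).+1.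
Proof.
move=> tour V_gt0; pose deg x := #|[set y in V | out x y]|.
have degE x : deg x = \sum_(y in V) out x y.
  rewrite /deg -sum1_card big_mkcond [RHS]big_mkcond; apply: eq_bigr => y _.
  by rewrite inE; case: (y \in V); case: (out x y).
have [/exists_inP[x xV le_x]|/exists_inPn small] :=
  boolP [exists x in V, #|V| <= (2 * deg x).+1]; first by exists x.
have le1 : \sum_(x in V) (2 * deg x + 2) <= #|V| * #|V|.
  rewrite -sum_nat_const; apply: leq_sum => x /small.
  by rewrite -ltnNge addn2.
have le2 : #|V| * #|V| <= \sum_(x in V) (1 + deg x) + \sum_(x in V) deg x.
  have -> : \sum_(x in V) deg x = \sum_(x in V) \sum_(y in V) out y x.
    by rewrite exchange_big; apply: eq_bigr => x _.
  rewrite -big_split -sum_nat_const; apply: leq_sum => x xV /=.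
  rewrite degE (_ : 1 = \sum_(y in V) (x == y)); last first.
    rewrite (bigD1 x) //= eqxx big1 ?addn0 // => y /andP[_].
    by rewrite eq_sym => /negbTE ->.
  rewrite -!big_split -sum1_card; apply: leq_sum => y yV /=.
  have [//|neq_xy] := eqVneq x y; move: (tour x y xV yV neq_xy).
  by case: (out x y); case: (out y x).
move: le1 le2; rewrite !big_split /= big1_eq !sum_nat_const; lia.
Qed.

Lemma expn_monol m n k : m <= n -> m ^ k <= n ^ k.
Proof. by case: k => // k le_mn; rewrite leq_exp2r. Qed.

(* Halving [g] decreases the weight at least [2 ^ K >= K] times, also at the last
   step from 1 to 0. *)
Definition weight K g := (2 * g + (g == 0)) ^ K.

Lemma weight_gt0 K g : 0 < weight K g.
Proof. by rewrite expn_gt0; case: g. Qed.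

Lemma leq_weight K g g' : g' <= g -> weight K g' <= weight K g.
Proof. by move=> le_g; apply: expn_monol; case: g g' le_g => [|g] [|g'] //=; lia. Qed.

Lemma weight_half K g g' : 0 < g -> g' <= g./2 -> K * weight K g' <= weight K g.
Proof.
move=> g_gt0 le_g; apply: (@leq_trans (2 ^ K * weight K g')).
  by rewrite leq_mul2r ltnW ?orbT // ltn_expl.
rewrite -expnMn; apply: expn_monol.
by case: g g' g_gt0 le_g => [|g] [|g'] //=; lia.
Qed.

(** * Chains on the two sides *)

Section Chains.

Variables (N n : nat) (chi : 'I_N -> 'I_N -> 'I_n).
Implicit Types (side : bool) (U V : {set 'I_N}) (x y : 'I_N).

Definition before side x y := if side then x < y else y < x.

Definition hue side x y : 'I_n := if side then chi x y else rev_ord (chi y x).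

Definition nbhd side V x (c : nat) :=
  [set y in V | before side x y && (hue side x y == c :> nat)].

(* The parameter [k] counts colors, one less than the vertices.  Each color bounds the later ones, and the first
   is below [a]. *)
Fixpoint chain side k a V : bool :=
  if k is k'.+1 then
    [exists x in V, exists c : 'I_n,
      (c < a) && chain side k' c.+1 (nbhd side V x c)]
  else V != set0.

Lemma hueC side x y : hue side x y + hue (~~ side) y x = n.-1.
Proof. by case: side => /=; [have := ltn_ord (chi x y)|have := ltn_ord (chi y x)]; lia. Qed.

Lemma chain_cons side k a V x (c : nat) : x \in V -> c < n -> c < a ->
  chain side k c.+1 (nbhd side V x c) -> chain side k.+1 a V.
Proof.
move=> xV c_n c_a ch; apply/exists_inP; exists x => //.
by apply/existsP; exists (Ordinal c_n); rewrite c_a.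
Qed.

Lemma chainS side k a b U V : U \subset V -> a <= b ->
  chain side k a U -> chain side k b V.
Proof.
elim: k a b U V => [|k IHk] a b U V sUV le_ab /=.
  by apply: contraNneq => V0; rewrite -subset0 -V0.
case/exists_inP=> x xU /existsP[c /andP[c_a ch]].
apply: (@chain_cons _ _ _ _ x c); rewrite ?(subsetP sUV) //.
  exact: leq_trans le_ab.
apply: IHk ch => //; apply/subsetP=> y; rewrite !inE.
by case/andP=> /(subsetP sUV) ->.
Qed.

Lemma chain_shorten side k l a V : l <= k -> chain side k a V -> chain side l a V.
Proof.
elim: k l a V => [|k IHk] [|l] a V //= le_lk.
  by case/exists_inP=> x xV _; apply/set0Pn; exists x.
case/exists_inP=> x xV /existsP[c /andP[c_a ch]].
exact: (chain_cons xV (ltn_ord c) c_a (IHk _ _ _ le_lk ch)).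
Qed.

Lemma chain_threshold0 side k V : ~~ chain side k.+1 0 V.
Proof. by apply/exists_inPn => x _; apply/existsPn => c. Qed.

Lemma chain1 side a V x y : x \in V -> y \in V -> before side x y ->
  hue side x y < a -> chain side 1 a V.
Proof.
move=> xV yV xy lt_a; apply: (chain_cons xV (ltn_ord (hue side x y)) lt_a).
by apply/set0Pn; exists y; rewrite inE yV xy /=.
Qed.

Lemma before_total side x y : x != y -> before side x y || before side y x.
Proof. by rewrite -val_eqE /before => /=; case: side; lia. Qed.

Lemma beforeC side x y : before (~~ side) y x = before side x y.
Proof. by case: side. Qed.

Lemma no_chain1 side V : ~~ chain side 1 n V -> #|V| <= 1.
Proof.
move=> no; rewrite leqNgt; apply: contra no => /card_gt1P[x [y [xV yV neq]]].
case/orP: (before_total side neq) => xy; last exact: (chain1 yV xV xy).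
exact: (chain1 xV yV xy).
Qed.

(* Replacing "some [U'] inside every [U]" by a single large subset of [V] would
   cost a factor [n] at every step. *)
Definition avoidable side k a V := forall U, U \subset V ->
  exists U', [/\ U' \subset U, ~~ chain side k a U' & #|U| <= n * #|U'|].

Lemma avoidableS side k a U V :
  U \subset V -> avoidable side k a V -> avoidable side k a U.
Proof. by move=> sUV av W sWU; apply: av; apply: subset_trans sUV. Qed.

Lemma avoidable0 side k V : 0 < n -> avoidable side k.+1 0 V.
Proof.
move=> n_gt0 U _; exists U; split=> //; last exact: leq_pmull.
exact: chain_threshold0.
Qed.

Lemma avoidable_nbhd side k a m V x U :
  0 < n -> x \in V -> ~~ chain side k.+1 a V -> U \subset V ->
  {in U, forall y, before side x y && (m <= hue side x y < a)} ->
  avoidable side k m.+1 U.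
Proof.
move=> n_gt0 xV no sUV hU W sWU.
have [|c] := @pigeonhole _ _ (Ordinal n_gt0) W
    (fun c y => before side x y && (m <= hue side x y < a) && (hue side x y == c)).
  by move=> y /(subsetP sWU)/hU ->; exists (hue side x y) => /=.
rewrite card_ord; set W' := [set _ in _ | _] => le_W; exists W'; split=> //.
  by apply/subsetP=> y; rewrite inE => /andP[].
have [->|[y]] := set_0Vmem W'.
  by case: k {no} => [|k] /=; rewrite ?eqxx //; apply/exists_inPn=> y; rewrite inE.
rewrite inE => /andP[_ /andP[/and3P[_ m_y y_a] /eqP yc]].
(* As [m <= c], a chain below [m.+1] in this color class is also one below [c.+1], so [x] extends
   it. *)
apply: contra no => ch; apply: (chain_cons xV (ltn_ord c)); rewrite -?yc //.
apply: chainS ch => //; apply/subsetP=> z.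
rewrite !inE => /andP[zW /andP[/andP[xz _] /eqP zc]].
by rewrite (subsetP sUV) ?(subsetP sWU) //= xz zc yc /=.
Qed.

(** * Slack of a pair of thresholds and its halving *)

Definition coord p q side (d : 'I_p * 'I_q) : nat :=
  if side then nat_of_ord d.1 else nat_of_ord d.2.

(* Truncated: the slack is 0 once the two thresholds together cover all colors. *)
Definition slack (e : bool -> nat -> nat) p q (d : 'I_p * 'I_q) :=
  n - (e true d.1 + e false d.2).

Definition raise (e : bool -> nat -> nat) side k m : bool -> nat -> nat :=
  fun side' k' => if (side' == side) && (k' == k) then m else e side' k'.

(** At positive slack the two midpoints add up to [n.-1], so every color reaches the midpoint on one
    of the sides. *)
Definition midpoint e p q side (d : 'I_p * 'I_q) :=
  e side (coord side d) +
  (if side then (slack e d)./2 else (slack e d - (slack e d)./2).-1).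

Lemma slack_raise e p q side k m (d : 'I_p * 'I_q) :
  e side k <= m -> slack (raise e side k m) d <= slack e d.
Proof.
move=> le_m; rewrite /slack leq_sub2l // leq_add // /raise.
  by case: ifP => // /andP[/eqP-> /eqP->].
by case: ifP => // /andP[/eqP-> /eqP->].
Qed.

Lemma slack_midpoint e p q side (d : 'I_p * 'I_q) : 0 < slack e d ->
  slack (raise e side (coord side d) (midpoint e side d).+1) d <= (slack e d)./2.
Proof.
rewrite {2 3}/slack /raise /midpoint /slack /coord.
by case: side => /=; rewrite eqxx /=; lia.
Qed.

Lemma halve_slack A e V p q :
  0 < n -> 1 < #|V| ->
  (forall side (d : 'I_p * 'I_q),
     ~~ chain side (coord side d).+2 (A side (coord side d).+1) V) ->
  (forall c c', c + c' = n.-1 -> exists d : 'I_p * 'I_q,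
     [/\ 0 < slack A d, c < A true d.1.+1 & c' < A false d.2.+1]) ->
  (forall d : 'I_p * 'I_q, 0 < slack A d -> 0 < slack e d) ->
  exists side (d : 'I_p * 'I_q) U,
    [/\ 0 < slack e d, U \subset V, #|V| <= 8 * p * q * #|U| &
        avoidable side (coord side d).+1 (midpoint e side d).+1 U].
Proof.
move=> n_gt0 V_gt1 noA cover slack_gt0.
(* A label [k] is a side and a pair of indices; it directs an edge away from the vertex that comes
   first on that side. *)
pose P (k : bool * ('I_p * 'I_q)) x y := before k.1 x y && (0 < slack A k.2) &&
  (midpoint e k.1 k.2 <= hue k.1 x y < A k.1 (coord k.1 k.2).+1).
have tour x y : x < y -> exists k, P k x y || P k y x.
  move=> lt_xy; have [d [open_d c_lt c'_lt]] := cover _ _ (hueC true x y).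
  have := hueC true x y; have := slack_gt0 d open_d.
  case: (leqP (midpoint e true d) (hue true x y)) => [le1 _ _|lt1 gt0 sum_c].
    by exists (true, d); rewrite /P [before _ _ _]lt_xy open_d le1 c_lt.
  exists (false, d); apply/orP; right.
  rewrite /P [before _ _ _]lt_xy open_d c'_lt andbT /=.
  by move: lt1 sum_c gt0; rewrite /midpoint /slack /coord /=; lia.
have [||x xV le_V] := @large_outdegree _ V (fun x y => [exists k, P k x y]).
- move=> x y _ _; rewrite -val_eqE neq_ltn => /orP[] /tour[k /orP[]] Pk.
  + by apply/orP; left; apply/existsP; exists k.
  + by apply/orP; right; apply/existsP; exists k.
  + by apply/orP; right; apply/existsP; exists k.
  + by apply/orP; left; apply/existsP; exists k.
- exact: ltnW.
have [d0 _] : exists d : 'I_p * 'I_q, 0 < slack A d.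
  by have [d []] := cover 0 n.-1 (add0n _); exists d.
have [|[side d]] := @pigeonhole _ _ (true, d0)
  [set y in V | [exists k, P k x y]] (fun k y => P k x y).
  by move=> y; rewrite inE => /andP[_ /existsP].
rewrite !card_prod card_bool !card_ord; set U := [set y in [set _ in _ | _] | _] => le_U.
have sUV : U \subset V by apply/subsetP=> y; rewrite !inE => /andP[/andP[]].
have U_gt0 : 0 < #|U| by case: #|U| le_U => //; lia.
have hU : {in U, forall y, P (side, d) x y} by move=> y; rewrite inE => /andP[].
exists side, d, U; split=> //.
- by have /card_gt0P[y /hU/andP[/andP[_]]] := U_gt0; move=> op _; apply: slack_gt0.
(* A factor 2 comes from the out-degree, [2 * p * q] from the labels, and another 2 absorbs the
   additive 1. *)
- by move: le_V le_U V_gt1; nia.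
apply: (avoidable_nbhd n_gt0 xV (noA side d) sUV) => y /hU/andP[/andP[-> _]].
by [].
Qed.

(** * The potential argument *)

Definition potential e p q :=
  \prod_(d : 'I_p * 'I_q) weight (8 * p * q) (slack e d).

(** [A] stays fixed while the avoidable thresholds [e] rise. The factor [8 * p * q] of a halving is
    paid by the weight of the halved pair. Once an open pair has no slack in [e], two avoidances,
    each losing a factor [n], lead to [closed]. *)
Lemma card_le_potential A B V p q :
  0 < n -> 0 < B ->
  (forall side (d : 'I_p * 'I_q),
     ~~ chain side (coord side d).+2 (A side (coord side d).+1) V) ->
  (forall c c', c + c' = n.-1 -> exists d : 'I_p * 'I_q,
     [/\ 0 < slack A d, c < A true d.1.+1 & c' < A false d.2.+1]) ->
  (forall U (d : 'I_p * 'I_q) a b, U \subset V -> 0 < slack A d ->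
     ~~ chain true d.1.+1 a U -> ~~ chain false d.2.+1 b U -> n <= a + b ->
     #|U| <= B) ->
  forall e U, U \subset V ->
  (forall side (d : 'I_p * 'I_q),
     avoidable side (coord side d).+1 (e side (coord side d)) U) ->
  #|U| <= n ^ 2 * B * potential e p q.
Proof.
move=> n_gt0 B_gt0 noA cover closed e U.
have [s] := ubnP (\sum_(d : 'I_p * 'I_q) slack e d).
elim: s e U => // s IHs e U lt_s sUV av.
have pot_gt0 e' : 0 < potential e' p q by apply: prodn_gt0 => d; apply: weight_gt0.
have [/existsP[d /andP[open_d /eqP slack0]]|/existsPn none] :=
  boolP [exists d : 'I_p * 'I_q, (0 < slack A d) && (slack e d == 0)].
  have [U1 [sU1 no1 le1]] := av true d U (subxx _).
  have [U2 [sU2 no2 le2]] := av false d U1 sU1.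
  have leB : #|U2| <= B.
    apply: (closed U2 d (e true d.1) _ _ open_d _ no2).
    - exact: subset_trans sU2 (subset_trans sU1 sUV).
    - by apply: contra no1; apply: chainS.
    - by move: slack0; rewrite /slack /coord /=; lia.
  apply: (@leq_trans (n ^ 2 * B)); last by rewrite leq_pmulr.
  apply: leq_trans le1 _; rewrite -mulnn -mulnA leq_mul2l; apply/orP; right.
  by apply: leq_trans le2 _; rewrite leq_mul2l leB orbT.
have [U_le1|U_gt1] := leqP #|U| 1.
  by apply: leq_trans U_le1 _; rewrite !muln_gt0 n_gt0 B_gt0 pot_gt0.
have [||side [d [W [gt0 sWU le_U avW]]]] := @halve_slack A e U p q n_gt0 U_gt1 _ cover.
- by move=> side d; apply: contra (noA side d); apply: chainS.
- by move=> d open_d; have := none d; rewrite open_d /=; lia.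
set e' := raise e side (coord side d) (midpoint e side d).+1.
have le_slack d' : slack e' d' <= slack e d'.
  by apply: slack_raise; rewrite /midpoint; lia.
have half : slack e' d <= (slack e d)./2 by apply: slack_midpoint.
have leW : #|W| <= n ^ 2 * B * potential e' p q.
  apply: IHs; last 1 first.
  - move=> side' d'; rewrite /e' /raise; case: ifP => [/andP[/eqP-> /eqP->]|_] //.
    exact: avoidableS (av _ _).
  - rewrite -ltnS; apply: leq_trans lt_s; rewrite ltnS.
    rewrite (bigD1 d) //= [leqRHS](bigD1 d) //= -addSn leq_add ?leq_sum //.
    by apply: leq_ltn_trans half _; lia.
  - exact: subset_trans sUV.
apply: leq_trans le_U _; apply: leq_trans (leq_mul (leqnn _) leW) _.
rewrite mulnCA leq_mul2l; apply/orP; right.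
rewrite /potential (bigD1 d) //= [leqRHS](bigD1 d) //= mulnA leq_mul //.
  exact: weight_half.
by apply: leq_prod => d' _; apply: leq_weight.
Qed.

(** * Closing the open pairs one by one *)

Lemma chain_opposite side k a b V : ~~ chain (~~ side) 1 b V -> n <= a + b ->
  chain side k.+1 n V -> chain side k.+1 a V.
Proof.
move=> no le_n /exists_inP[x xV /existsP[c /andP[_ ch]]].
apply: (chain_cons xV (ltn_ord c) _ ch).
have /set0Pn[y] := chain_shorten (leq0n _) ch.
(* Reversed, the edge from [x] to [y] is a chain of two vertices on the other side, so its color
   there is at least [b]. *)
rewrite inE => /and3P[yV xy /eqP hc].
have le_b : b <= hue (~~ side) y x.
  by rewrite leqNgt; apply: contra no; apply: chain1; rewrite ?beforeC.
by have := hueC side x y; have := ltn_ord (hue side x y); rewrite -hc; lia.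
Qed.

(** Two avoidances times the potential at [e = 0], where all [p * q] pairs have slack [n]. *)
Definition phase_bound p q :=
  n ^ 2 * ((2 * n) ^ (8 * p * q)) ^ (p * q).

(** For the least [i] and [j] that work, minimality bounds the lower thresholds by [c] and [c'],
    whose sum is below [n]; at index 0 the hypotheses take over. *)
Lemma colors_covered A p q : 0 < p -> 0 < q ->
  A true p = n -> A false q = n ->
  (forall i : 'I_p, A true i + A false 0 < n) ->
  (forall j : 'I_q, A true 0 + A false j < n) ->
  forall c c', c + c' = n.-1 -> exists d : 'I_p * 'I_q,
    [/\ 0 < slack A d, c < A true d.1.+1 & c' < A false d.2.+1].
Proof.
case: p q => [|p] [|q] // _ _ Ap Aq gtT gtF c c' sum_c.
have n_gt0 : 0 < n by apply: leq_ltn_trans (gtT ord0).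
have exT : exists i, c < A true i.+1 by exists p; rewrite Ap; lia.
have exF : exists j, c' < A false j.+1 by exists q; rewrite Aq; lia.
case: (ex_minnP exT) => i c_i min_i; case: (ex_minnP exF) => j c'_j min_j.
have i_p : i < p.+1 by apply: min_i; rewrite Ap; lia.
have j_q : j < q.+1 by apply: min_j; rewrite Aq; lia.
exists (Ordinal i_p, Ordinal j_q); split=> //=; rewrite /slack /= subn_gt0.
case: i i_p c_i min_i => [|i] i_p _ min_i; first exact: (gtF (Ordinal j_q)).
case: j j_q c'_j min_j => [|j] j_q _ min_j; first exact: (gtT (Ordinal i_p)).
have : ~~ (c < A true i.+1) by apply/negP=> /min_i; rewrite ltnn.
have : ~~ (c' < A false j.+1) by apply/negP=> /min_j; rewrite ltnn.
by lia.
Qed.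

(** Induction on the number of open pairs: either [p] or [q] can be decreased, or a loss of
    [phase_bound] closes a pair. *)
Lemma card_open_le B p q : 0 < n -> 0 < B -> 0 < p -> 0 < q ->
  (forall V, ~~ chain true p n V -> ~~ chain false q.+1 n V -> #|V| <= B) ->
  (forall V, ~~ chain true p.+1 n V -> ~~ chain false q n V -> #|V| <= B) ->
  forall u A V, #|[set d : 'I_p * 'I_q | 0 < slack A d]| < u ->
  A true p = n -> A false q = n ->
  (forall side k, k <= (if side then p else q) ->
     ~~ chain side k.+1 (A side k) V) ->
  #|V| <= phase_bound p q ^ u.-1 * B.
Proof.
move=> n_gt0 B_gt0 p_gt0 q_gt0 IHp IHq.
have bound_gt0 : 0 < phase_bound p q.
  by rewrite /phase_bound muln_gt0 !expn_gt0 n_gt0 /= muln_gt0 n_gt0.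
elim=> [|u IHu] A V lt_u Ap Aq noA //.
have noTp : ~~ chain true p.+1 n V by rewrite -Ap (noA true).
have noFq : ~~ chain false q.+1 n V by rewrite -Aq (noA false).
have leB : #|V| <= B -> #|V| <= phase_bound p q ^ u * B.
  by move=> le; apply: leq_trans le _; rewrite leq_pmull // expn_gt0 bound_gt0.
have [/existsP[i le_n]|/existsPn gtT] :=
    boolP [exists i : 'I_p, n <= A true i + A false 0].
  apply/leB/IHp => //; apply: contra (noA true i (ltnW (ltn_ord i))) => ch.
  apply: (@chain_opposite true i _ _ _ (noA false 0 (leq0n _)) le_n).
  exact: chain_shorten ch.
have [/existsP[j le_n]|/existsPn gtF] :=
    boolP [exists j : 'I_q, n <= A false j + A true 0].
  apply/leB/IHq => //; apply: contra (noA false j (ltnW (ltn_ord j))) => ch.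
  apply: (@chain_opposite false j _ _ _ (noA true 0 (leq0n _)) le_n).
  exact: chain_shorten ch.
have cover : forall c c', c + c' = n.-1 -> exists d : 'I_p * 'I_q,
    [/\ 0 < slack A d, c < A true d.1.+1 & c' < A false d.2.+1].
  apply: colors_covered => // k; last by rewrite addnC ltnNge.
  by rewrite ltnNge.
case: u => [|u] in IHu lt_u leB *.
  have [d [open_d _ _]] := cover 0 n.-1 (add0n _).
  by move: lt_u; rewrite ltnS leqn0 cards_eq0 => /eqP/setP/(_ d); rewrite !inE open_d.
rewrite expnS.
have B'_gt0 : 0 < phase_bound p q ^ u * B by rewrite muln_gt0 expn_gt0 bound_gt0.
apply: leq_trans (@card_le_potential A (phase_bound p q ^ u * B) V p q n_gt0 B'_gt0 _ cover _
  (fun _ _ => 0) V (subxx _) _) _.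
- move=> side d; apply: noA; rewrite /coord; case: side; exact: ltn_ord.
- move=> U d a b sUV open_d no1 no2 le_n.
  (* The maxima keep closed pairs closed, and [d] closes because [n <= a + b]. *)
  pose A1 := raise A true d.1 (maxn (A true d.1) a).
  pose A2 := raise A1 false d.2 (maxn (A false d.2) b).
  have A1_le (e : 'I_p * 'I_q) : slack A1 e <= slack A e by apply: slack_raise; rewrite leq_maxl.
  have A2_le (e : 'I_p * 'I_q) : slack A2 e <= slack A e.
    by apply: leq_trans (A1_le e); apply: slack_raise; rewrite leq_maxl.
  apply: (IHu A2).
  + move: lt_u; rewrite ltnS; apply: leq_trans.
    apply: proper_card; apply/properP; split.
      by apply/subsetP=> e; rewrite !inE => /leq_trans; apply.
    exists d; rewrite !inE // /slack /A2 /A1 /raise /= !eqxx /=; lia.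
  + by rewrite /A2 /A1 /raise /= gtn_eqF.
  + by rewrite /A2 /A1 /raise /= gtn_eqF.
  have noAU side k : k <= (if side then p else q) -> ~~ chain side k.+1 (A side k) U.
    by move=> le_k; apply: contra (noA side k le_k); apply: chainS.
  case=> k le_k; rewrite /A2 /A1 /raise /=; case: eqP => [->|_]; rewrite ?noAU //.
  + by rewrite /maxn; case: ifP => _ //; rewrite noAU // ltnW.
  + by rewrite /maxn; case: ifP => _ //; rewrite noAU // ltnW.
- by move=> side d; apply: avoidable0.
rewrite mulnAC mulnA leq_mul2r; apply/orP; right.
have -> : potential (fun _ _ => 0) p q = ((2 * n) ^ (8 * p * q)) ^ (p * q).
  rewrite /potential /slack /weight addn0 subn0 prod_nat_const card_prod !card_ord.
  by rewrite eqn0Ngt n_gt0 addn0.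
by rewrite mulnAC.
Qed.

(** * From chains to lexicographic sets *)

Lemma chain_sequence side k a V : chain side k a V ->
  exists x : nat -> 'I_N,
    [/\ forall i, i <= k -> x i \in V,
        forall i j, i < j <= k -> before side (x i) (x j) /\
          hue side (x i) (x j) = hue side (x i) (x i.+1),
        forall i, i < k -> hue side (x i) (x i.+1) < a &
        forall i j, i <= j < k ->
          hue side (x j) (x j.+1) <= hue side (x i) (x i.+1)].
Proof.
elim: k a V => [|k IHk] a V.
  by case/set0Pn=> x xV; exists (fun _ => x); split=> // i j; lia.
case/exists_inP=> x xV /existsP[c /andP[c_a /IHk[y [yV y_lex y_c y_dec]]]].
have xy i : i <= k -> [/\ y i \in V, before side x (y i) & hue side x (y i) = c].
  by move/yV; rewrite inE => /and3P[? ? /eqP/val_inj].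
exists (fun i => if i is i'.+1 then y i' else x); split.
- by case=> // i /xy[].
- case=> [|i] [|j] //=; last exact: y_lex.
  by case/xy=> _ -> ->; have [_ _ ->] := xy 0 (leq0n k).
- case=> [_|i lt_i]; first by have [_ _ ->] := xy 0 (leq0n k).
  by apply: leq_trans c_a; apply: y_c.
case=> [|i] [|j] //= le_ij; last exact: y_dec.
by have [_ _ ->] := xy 0 (leq0n k); rewrite -ltnS y_c.
Qed.

Lemma chain_lexicographic side k V : chain side k n V ->
  exists S : {set 'I_N}, #|S| = k.+1 /\ lexicographic_nonincreasing chi k.+1 S.
Proof.
case/chain_sequence=> x [_ x_lex _ x_dec].
suff [X [c [X_inc X_lex c_dec]]] : exists (X : 'I_k.+1 -> 'I_N) (c : 'I_k -> 'I_n),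
    [/\ forall i j : 'I_k.+1, i < j -> X i < X j,
        (forall (i j : 'I_k.+1) (l : 'I_k), i < j -> l = i :> nat ->
           chi (X i) (X j) = c l)
        \/ (forall (i j : 'I_k.+1) (l : 'I_k), i < j -> l = j.-1 :> nat ->
           chi (X i) (X j) = c l) & nonincreasing_colors c].
  exists [set X i | i : 'I_k.+1]; split; last by exists c => //; exists X.
  rewrite card_imset ?card_ord // => i j eqX; apply: val_inj.
  by have [/X_inc|/X_inc|//] := ltngtP i j; rewrite eqX ltnn.
case: side x_lex x_dec => x_lex x_dec.
  exists (fun i => x i), (fun l => chi (x l) (x l.+1)); split.
  - by move=> i j lt_ij; apply: (x_lex i j _).1; rewrite lt_ij -ltnS ltn_ord.
  - left=> i j l lt_ij ->.
    by apply: (x_lex i j _).2; rewrite lt_ij -ltnS ltn_ord.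
  by move=> l l' le_l; apply: x_dec; rewrite le_l ltn_ord.
(* Read backwards, a chain on the second side is increasing and of kind (2). *)
exists (fun i => x (k - i)), (fun l => chi (x (k - l)) (x (k - l.+1))).
have lt_sub (i j : 'I_k.+1) : i < j -> k - j < k - i <= k.
  by have := ltn_ord j; lia.
split.
- by move=> i j /lt_sub/x_lex[].
- right=> i j l lt_ij def_l; apply: rev_ord_inj.
  have [_] := x_lex _ _ (lt_sub i j lt_ij).
  have -> : (k - j).+1 = k - l by have := ltn_ord j; lia.
  have -> : k - j = k - l.+1 by have := ltn_ord j; lia.
  by [].
move=> l l' le_l; have := x_dec (k - l'.+1) (k - l.+1) _.
have -> : (k - l'.+1).+1 = k - l' by have := ltn_ord l'; lia.
have -> : (k - l.+1).+1 = k - l by have := ltn_ord l; lia.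
have := ltn_ord l.
have := ltn_ord (chi (x (k - l)) (x (k - l.+1))).
have := ltn_ord (chi (x (k - l')) (x (k - l'.+1))).
by rewrite /=; lia.
Qed.

End Chains.

(** * The polynomial bound *)

Lemma polynomial_bound p q : exists C,
  forall n N (chi : 'I_N -> 'I_N -> 'I_n) (V : {set 'I_N}), 0 < n ->
    ~~ chain chi true p.+1 n V -> ~~ chain chi false q.+1 n V ->
    #|V| <= C * n ^ C.
Proof.
elim: p q => [|p IHp] q.
  by exists 1 => n N chi V n_gt0 /no_chain1 V_le1 _; rewrite mul1n (leq_trans V_le1).
elim: q => [|q [C2 IHq]].
  by exists 1 => n N chi V n_gt0 _ /no_chain1 V_le1; rewrite mul1n (leq_trans V_le1).
have [C1 {}IHp] := IHp q.+1.
(* [phase_bound] equals [2 ^ K * n ^ (2 + K)], and there are at most [u] open pairs. *)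
pose K := 8 * p.+1 * q.+1 * (p.+1 * q.+1); pose u := p.+1 * q.+1.
pose a := 2 ^ (K * u) * (C1 + C2).+1; pose b := (2 + K) * u + (C1 + C2).
exists (a + b) => n N chi V n_gt0 noT noF.
pose B := (C1 + C2).+1 * n ^ (C1 + C2).
have B_ge C : C <= C1 + C2 -> C * n ^ C <= B.
  by move=> le_C; rewrite leq_mul // ?leq_pexp2l // (leq_trans le_C).
have B_gt0 : 0 < B by rewrite muln_gt0 expn_gt0 n_gt0.
(* Trivial thresholds: 0 excludes every chain with an edge, and [n] at the last index is the
   hypothesis on [V]. *)
pose A side k := if k == (if side then p.+1 else q.+1) then n else 0.
have : #|V| <= phase_bound n p.+1 q.+1 ^ u * B.
  apply: (@card_open_le _ _ chi B p.+1 q.+1 n_gt0 B_gt0 _ _ _ _ u.+1 A) => //.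
  - move=> W noT' noF'; apply: leq_trans (B_ge C1 (leq_addr _ _)).
    exact: (IHp n N chi).
  - move=> W noT' noF'; apply: leq_trans (B_ge C2 (leq_addl _ _)).
    exact: (IHq n N chi).
  - by rewrite ltnS (leq_trans (max_card _)) // card_prod !card_ord.
  - by rewrite /A eqxx.
  - by rewrite /A eqxx.
  - move=> side k _; rewrite /A; case: eqP => [->|_]; last exact: chain_threshold0.
    by case: side.
move/leq_trans; apply; apply: (@leq_trans (a * n ^ b)).
  rewrite /phase_bound -/u -expnM -/K !expnMn -!expnM /a /b mulnDl mul2n -addnn.
  rewrite (expnD n (u + u + _)) (expnD n (u + u)) (expnD n u u) /B.
  move: (2 ^ _) (n ^ (K * u)) (n ^ (C1 + C2)) => v w z; lia.
by rewrite leq_mul ?leq_addr // leq_pexp2l // leq_addl.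
Qed.

Theorem theorem1p6 (s : nat) (hs : 2 <= s) :
  exists2 C : nat, 0 < C &
    forall n : nat, 0 < n ->
    forall chi : 'I_(C * n ^ C) -> 'I_(C * n ^ C) -> 'I_n,
      exists S : {set 'I_(C * n ^ C)},
        #|S| = s /\ lexicographic_nonincreasing chi s S.
Proof.
case: s hs => [|[|k]] // _; have [C bounded] := polynomial_bound k k.
(* The successor makes the number of vertices exceed [C * n ^ C]. *)
exists C.+1 => // n n_gt0 chi.
have [ch|noT] := boolP (chain chi true k.+1 n setT).
  exact: chain_lexicographic ch.
have [ch|noF] := boolP (chain chi false k.+1 n setT).
  exact: chain_lexicographic ch.
have := bounded n _ chi setT n_gt0 noT noF.
rewrite cardsT card_ord leqNgt => /negP[].
by rewrite mulSn expnS -[ltnLHS]add0n -addSn leq_add ?leq_mul ?leq_pmull // ?muln_gt0 ?expn_gt0 n_gt0.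
Qed.
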